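(* Let $G$ be an open subgroup of a $\Pi$-separable non-meager right-topological group and let $X$ be a completely regular space such that $X\times X$ is countably compact. If $\pi\colon G\times X\to X$ is a separately continuous left action of $G$ on $X$, then $\pi$ is jointly continuous (i.e., $G\curvearrowright_\pi X$ is a topological flow).
   Context: No separation axioms are assumed unless stated. A right-topological group is a group with a topology such that every right translation $x\mapsto xs$ is continuous. A space is $\Pi$-separable if it is homeomorphic to the product of a family of separable spaces. A space is non-meager if it is not a countable union of sets whose closures have empty interior. A space $X$ is completely regular (not necessarily $T_1$) if for every $x\in X$ and neighborhood $U$ of $x$ there is a continuous $f\colon X\to[0,1]$ with $f(x)=0$ and $f\equiv1$ on $X\setminus U$. A space is countably compact if every countable open cover has a finite subcover. A left action $\pi\colon G\times X\to X$, $(t,x)\mapsto tx$, satisfies $ex=x$ and $(st)x=s(tx)$; it is separately continuous if $\pi$ is continuous in each variable when the other is fixed, and a topological flow if $\pi$ is jointly continuous. *)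

(* Defs.v *)
From HB Require Import structures.
From mathcomp Require Import all_boot all_order all_algebra.
From mathcomp Require Import all_classical all_reals all_analysis.

Set Implicit Arguments.
Unset Strict Implicit.
Unset Printing Implicit Defensive.

Import numFieldNormedType.Exports.

Local Open Scope classical_set_scope.

Section spaces.
Implicit Types T X Y : topologicalType.

Definition homeomorphic X Y : Prop :=
  exists (f : X -> Y) (g : Y -> X),
    [/\ cancel f g, cancel g f, continuous f & continuous g].

Definition separable T : Prop := exists2 D : set T, countable D & dense D.

Definition Pi_separable T : Prop :=
  exists (I : Type) (S : I -> topologicalType),
    (forall i, separable (S i)) /\ homeomorphic T (prod_topology S).

Definition non_meager T : Prop :=
  ~ exists F : nat -> set T,
      (forall n, interior (closure (F n)) = set0) /\
      \bigcup_n F n = [set: T].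

(* Unlike [completely_regular_space] of the library, which asks for a
   separating uniformity, this is phrased with real-valued functions. No
   separation axiom is included. *)
Definition completely_regular (R : realType) X : Prop :=
  forall (x : X) (U : set X), nbhs x U ->
    exists f : X -> R,
      [/\ continuous f, (forall y, 0 <= f y <= 1)%R, f x = 0%R
        & forall y, ~ U y -> f y = 1%R].

Definition countably_compact T : Prop :=
  forall U : nat -> set T, (forall n, open (U n)) ->
    [set: T] `<=` \bigcup_n U n ->
    finite_subset_cover [set: nat] U [set: T].

End spaces.

HB.structure Definition PreTopologicalGroup := {G of Group G & Topological G}.

HB.mixin Record PreTopologicalGroup_isRightTopological G
    of PreTopologicalGroup G := {
  mulg_right_continuous : forall s : G, continuous (fun x : G => (x * s)%g)
}.

#[short(type="rightTopologicalGroupType")]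
HB.structure Definition RightTopologicalGroup :=
  {G of PreTopologicalGroup_isRightTopological G & PreTopologicalGroup G}.

Record openSubgroup (H : rightTopologicalGroupType) := OpenSubgroup {
  openSubgroup_set :> set H;
  openSubgroup_open : open openSubgroup_set;
  openSubgroup_group_closed : group_closed (mem openSubgroup_set)
}.

(* The carrier of an open subgroup [G] is the library's type [set_type G] of
   elements of the set [G], which already carries the subspace topology; here it
   receives the group structure induced from the ambient group. *)
Section openSubgroup_group.
Variables (H : rightTopologicalGroupType) (G : openSubgroup H).

HB.instance Definition _ :=
  SubChoice.copy (set_type G) {x : H | x \in (G : set H)}.
HB.instance Definition _ := SubChoice_isSubGroup.Build H _ (set_type G)
  (openSubgroup_group_closed G).

End openSubgroup_group.

Section actions.
Variables (G : PreTopologicalGroup.type) (X : topologicalType).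
Implicit Type pi : G * X -> X.

Definition left_action pi : Prop :=
  (forall x, pi (1%g, x) = x) /\
  (forall s t x, pi ((s * t)%g, x) = pi (s, pi (t, x))).

Definition separately_continuous pi : Prop :=
  (forall t, continuous (fun x => pi (t, x))) /\
  (forall x, continuous (fun t => pi (t, x))).

End actions.

(* Main.v *)
Require Import Defs.
From HB Require Import structures.
From mathcomp Require Import all_boot all_order all_algebra.
From mathcomp Require Import all_classical all_reals all_analysis.
From mathcomp Require Import lra.

(** Translating by group elements reduces joint continuity to the following: for
    each continuous [f : X -> [0, 1]] and [eps > 0], every [g] close to [1]
    satisfies [|f (g y) - f y| <= eps] for all [y] at once
    ([action_equicontinuous]). Indeed, for [s] near [t] write
    [s y = (s t^-1) (t y)]; then [f (s y)] is close to [f (t y)], which is close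
    to [f (t x)] for [y] near [x], and complete regularity provides enough
    functions [f].

    This estimate follows, again by translation, as soon as the separately
    continuous function [(t, x) |-> f (t x)] has oscillation at most [eps],
    uniformly in [x], on some nonempty open set of [t]. An open subgroup [G] is
    an equivariant continuous retract of the ambient group
    ([open_subgroup_retract]), so the search for this open set can take place in
    the ambient group, that is, in a non-meager product [T] of separable spaces
    ([small_oscillation]).

    Suppose then that [F : T -> X -> [0, 1]] is separately continuous and that no
    nonempty open set has small oscillation. Given finitely many points of [T],
    densely many [t] admit a pair [x, y] with [F u x] and [F u y] almost equal at
    each of the given points [u], while [F t x] and [F t y] are far apart
    ([exists_close_pair]). Were [T] separable, with dense sequence [u_n], Baire
    category would give one [t] and pairs [x_n, y_n] that are asymptotically not
    separated by any [F u_k] but are separated by [F t]; a cluster point [(x, y)]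
    of these pairs in [X * X] would satisfy [F u_k x = F u_k y] for all [k] but
    [F t x <> F t y], against the density of the [u_k].

    In general [T] may have no countable dense set, but it has the countable
    chain condition ([disjoint_open_countable]), so each of the dense open sets
    to which Baire category is applied can be taken to be a countable union of
    open sets depending on finitely many coordinates
    ([dense_determined_cover]). A closing-off argument
    ([countable_reflecting_set]) gives a countable set of points of [T] that is
    dense as far as the countably many coordinates appearing in the open sets
    built from it are concerned: the given [t] can be moved into its closure
    without leaving these open sets, and the previous argument applies. *)

Set Implicit Arguments.
Unset Strict Implicit.
Unset Printing Implicit Defensive.

Import Order.TTheory GRing.Theory Num.Theory.
Import numFieldNormedType.Exports.

Local Open Scope classical_set_scope.

(** * Baire category and countable compactness over countable index types *)

Section baire_and_compactness.
Variables (T : topologicalType) (C : countType).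

Lemma non_meager_bigcap_dense (W : C -> set T) :
  non_meager T -> (forall c, open (W c)) -> (forall c, dense (W c)) ->
  exists t, forall c, W c t.
Proof.
move=> nmT oW dW; apply: contrapT => noW; apply: nmT.
pose F n := if unpickle n is Some c then ~` W c else set0.
have cF n : closed (F n).
  by rewrite /F; case: unpickle => [c|]; [exact: open_closedC|exact: closed0].
exists F; split=> [n|].
  rewrite -(closure_id _).1//; apply/eqP/negPn/negP => /set0P[t].
  rewrite /F; case: (unpickle n) => [c|]; last by move/interior_subset.
  move=> ct; have [||u [/interior_subset]] := dW c (~` W c)°; [by exists t|exact: open_interior|by []].
apply/seteqP; split=> // t _; apply: contrapT => Ft; apply: noW; exists t => c.
by apply: contrapT => Wt; apply: Ft; exists (pickle c) => //; rewrite /F pickleK.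
Qed.

Lemma countably_compact_bigcap (K : C -> set T) :
  countably_compact T -> (forall c, closed (K c)) ->
  (forall s : seq C, exists t, forall c, c \in s -> K c t) ->
  exists t, forall c, K c t.
Proof.
move=> ccT cK fip; apply: contrapT => noK.
pose U n := if unpickle n is Some c then ~` K c else set0.
have [n|t _|D _ DU] := ccT U.
- by rewrite /U; case: unpickle => [c|]; [exact: closed_openC|exact: open0].
- apply: contrapT => Ut; apply: noK; exists t => c.
  by apply: contrapT => Kt; apply: Ut; exists (pickle c) => //; rewrite /U pickleK.
- have [t Kt] := fip (pmap unpickle (finmap.enum_fset D)).
  have [n Dn] := DU t I; rewrite /U; case E: (unpickle n) => [c|//]; apply.
  by apply: Kt; rewrite mem_pmap; apply/mapP; exists n.
Qed.

End baire_and_compactness.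

Lemma homeomorphic_non_meager (X Y : topologicalType) (p : X -> Y) (q : Y -> X) :
  cancel p q -> cancel q p -> continuous p -> continuous q ->
  non_meager X -> non_meager Y.
Proof.
move=> pK qK cp cq nmX [F [F0 FT]]; apply: nmX; exists (fun n => p @^-1` F n).
split=> [n|]; last first.
  apply/seteqP; split=> // x _; have : [set: Y] (p x) by [].
  by rewrite -FT => -[n _ Fn]; exists n.
apply/seteqP; split=> // x; rewrite /interior => Nx.
suff : nbhs (p x) (closure (F n)) by move: (F0 n) => /seteqP[+ _]; exact.
have Nq : nbhs (q (p x)) (closure (p @^-1` F n)) by rewrite pK.
have : nbhs (p x) (q @^-1` closure (p @^-1` F n)) := cq (p x) _ Nq.
apply: filterS => y /= cly M My.
have [z [Fz Mz]] := cly (p @^-1` M) (cp (q y) M ltac:(by rewrite qK)).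
by exists (p z).
Qed.

Lemma separable_dense_range (T : topologicalType) (a : T) :
  separable T -> exists d : nat -> T, dense (range d).
Proof.
move=> [D /countable_injP[g gI] dD].
exists (fun n => xget a [set y | D y /\ g y = n]) => V V0 oV.
have [y [Vy Dy]] := dD _ V0 oV; exists y; split=> //; exists (g y) => //.
case: xgetP => [z _ [Dz gz]|/(_ y)[]//].
by apply: gI => //; exact: mem_set.
Qed.

(** * The countable chain condition for products of separable spaces *)

(** The countable chain condition for finite partial functions into [nat]. Fix
    [p0] in the family: each other member disagrees with [p0] at some point [i] of
    the finite domain of [p0], hence takes one of countably many values [w] there.
    The members with value [w] at [i] stay incompatible when [i] is removed from
    their domains, so that induction on the size of the domains applies. *)
Lemma countable_incompatible (I : eqType) (n : nat) (A : set (I -> option nat)) :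
  (forall p, A p -> exists2 l : seq I, (size l <= n)%N & forall i, p i <> None -> i \in l) ->
  (forall p q, A p -> A q -> p <> q ->
     exists i v w, [/\ p i = Some v, q i = Some w & v <> w]) ->
  countable A.
Proof.
elim: n A => [|n IHn] A domA incA.
  apply: (@sub_countable _ _ _ [set fun=> None]); last exact: countable1.
  apply: subset_card_le => p /domA[l]; rewrite leqn0 => /nilP -> pN.
  by apply/funext => i; apply: contrapT => /pN.
have [->|/set0P[p0 Ap0]] := eqVneq A set0; first exact: countable0.
have [l0 _ domp0] := domA _ Ap0.
pose A_ i w := [set p | A p /\ p i = Some w].
apply: (@sub_countable _ _ _
    ([set p0] `|` \bigcup_(i in [set` l0]) \bigcup_w A_ i w)).
  apply: subset_card_le => p Ap; have [->|pp0] := pselect (p = p0); first by left.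
  have [i [v [w [p0i pi _]]]] := incA _ _ Ap0 Ap (nesym pp0).
  by right; exists i; [apply: domp0; rewrite p0i|exists w].
rewrite -bigcup2E; apply: bigcup_countable => // -[_|[_|//]] /=.
- exact: countable1.
apply: bigcup_countable => [|i _]; first exact/finite_set_countable/finite_seq.
apply: bigcup_countable => // w _.
pose er (p : I -> option nat) j := if j == i then None else p j.
(* On [A_ i w] no information is lost by erasing the value at [i]. *)
have erI : {in A_ i w &, injective er}.
  move=> p q /set_mem[_ pi] /set_mem[_ qi] pq; apply/funext => j.
  by have := congr1 (@^~ j) pq; rewrite /er; case: eqP => // ->; rewrite pi qi.
rewrite -(eq_countable (inj_card_eq erI)); apply: IHn.
  move=> _ [p [Ap pi] <-]; have [l sl pl] := domA _ Ap.
  exists [seq j <- l | j != i].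
    have il : i \in l by apply: pl; rewrite pi.
    rewrite size_filter -ltnS (leq_trans _ sl)// -(count_predC (pred1 i) l).
    by rewrite -[X in (X < _)%N]add0n ltn_add2r -has_count has_pred1.
  by move=> j; rewrite /er mem_filter /=; case: eqP => //= _; exact: pl.
move=> _ _ [p [Ap pi] <-] [q [Aq qi] <-] pq.
have [|j [v [u [pj qj vu]]]] := incA _ _ Ap Aq; first by move=> E; apply: pq; rewrite E.
exists j, v, u; rewrite /er; case: eqP => // E; exfalso; apply: vu.
by move: pj qj; rewrite E pi qi => -[<-] [<-].
Qed.

(** The finite trees labelled by [nat] are the terms built from countably many
    operations of every arity. *)
Fixpoint skolem_term (A : Type) (Phi : seq A -> nat -> A) (c : GenTree.tree nat) : A :=
  match c with
  | GenTree.Leaf n => Phi [::] n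
  | GenTree.Node n s => Phi (map (skolem_term Phi) s) n
  end.

Section product_of_separable_spaces.
Variables (I : choiceType) (S : I -> topologicalType).
Local Notation T := (prod_topology S).
Implicit Types (t u : T) (B V W : set T) (l : seq I).

(** The open sets of interest are not themselves boxes, but they are cut out by
    finitely many coordinates; [determined_by] retains only that. *)
Definition determined_by l B :=
  forall t u, (forall i, i \in l -> t i = u i) -> B t -> B u.

Definition box l (U : forall i, set (S i)) : set T :=
  [set t | forall i, i \in l -> U i (t i)].

Lemma box_determined l U : determined_by l (box l U).
Proof. by move=> t u tu Bt i il; rewrite -tu//; exact: Bt. Qed.

Lemma open_box l U : (forall i, open (U i)) -> open (box l U).
Proof.
move=> oU; elim: l => [|i l IHl].
  by rewrite (_ : box _ _ = setT); [exact: openT|apply/seteqP; split].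
rewrite (_ : box _ _ = (@proj I S i @^-1` U i) `&` box l U).
  by apply: openI => //; apply: open_comp => // u _; exact: proj_continuous.
apply/seteqP; split=> [u Bu|u [Ui Bu] j].
  by split=> [|j jl]; apply: Bu; rewrite inE ?eqxx// jl orbT.
by rewrite inE => /predU1P[->//|]; exact: Bu.
Qed.

Lemma nbhs_box t (N : set T) : nbhs t N ->
  exists l U, [/\ forall i, open (U i), box l U t & box l U `<=` N].
Proof.
pose F : set_system T := [set M |
  exists l U, [/\ forall i, open (U i), box l U t & box l U `<=` M]].
have FF : Filter F.
  split=> [|M1 M2 [l1 [U1 [opU t1 s1]]] [l2 [U2 [opV t2 s2]]]|M M2 sM [l [U [opU t1 s1]]]].
  - by exists [::], (fun=> setT); split=> // i; exact: openT.
  - exists (l1 ++ l2), (fun i => (if i \in l1 then U1 i else setT) `&`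
                                 (if i \in l2 then U2 i else setT)); split=> [i|i|u Bu].
    + by apply: openI; case: ifP => // _; exact: openT.
    + by move=> _; split; case: ifP => // ?; [exact: t1|exact: t2].
    + split; [apply: s1|apply: s2] => i il.
        by have [|+ _] := Bu i; rewrite ?mem_cat il.
      by have [|_ +] := Bu i; rewrite ?mem_cat il ?orbT.
  - by exists l, U; split=> //; exact: subset_trans sM.
move=> Nt; suff Ft : F --> t by exact: (Ft _ Nt).
apply/cvg_sup => i M; rewrite nbhsE => -[A [[V oV <-] Vt] AM].
pose U := dfwith (fun j => [set: S j]) i V.
exists [:: i], U; split.
- by move=> j; rewrite /U; case: dfwithP => // *; exact: openT.
- by move=> j; rewrite inE => /eqP ->; rewrite /U dfwithin.
- by move=> u /(_ i); rewrite inE eqxx /U dfwithin => Vu; apply: AM; exact: Vu.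
Qed.

Variable d : forall i, nat -> S i.
Hypothesis dense_d : forall i, dense (range (d i)).

Lemma dense_coordinate i (U : set (S i)) (x : S i) :
  open U -> U x -> exists n, U (d i n).
Proof.
by move=> oU Ux; have [|y [Uy [n _ E]]] := dense_d _ oU; [exists x|exists n; rewrite E].
Qed.

(** A nonempty open set contains every point that agrees, on finitely many
    coordinates, with well-chosen members of the dense sequences [d]; record these
    choices as a finite partial function from [I] to [nat]. Compatible partial
    functions have a common extension to a point of [T], so disjoint open sets
    have incompatible codes, of which there are only countably many. *)
Lemma disjoint_open_countable (E : set (set T)) :
  (forall B, E B -> open B /\ B !=set0) -> trivIset E id -> countable E.
Proof.
move=> oE disjE.
pose coded B l (p : I -> option nat) :=
  (forall i, p i <> None -> i \in l) /\
  forall t, (forall i n, p i = Some n -> t i = d i n) -> B t.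
have codeP B : E B -> exists lp, coded B lp.1 lp.2.
  move=> /oE[oB [t Bt]].
  have /nbhs_box[l [U [oU Ut UB]]] : nbhs t B by exact: open_nbhs_nbhs.
  have /choice[k kU] : forall i, exists n, i \in l -> U i (d i n).
    move=> i; have [il|/negbTE il] := boolP (i \in l); last by exists 0%N.
    by have [n] := dense_coordinate (oU i) (Ut i il); exists n.
  exists (l, fun i => if i \in l then Some (k i) else None); split=> /= [i|u uk].
    by case: ifP.
  by apply: UB => i il; rewrite (uk i (k i)) ?il//; exact: kU.
have /choice[code codeE] : forall B, exists lp, E B -> coded B lp.1 lp.2.
  move=> B; have [/codeP[lp]|EB] := pselect (E B); first by exists lp.
  by exists ([::], fun=> None).
have compat B C : E B -> E C -> B <> C ->
    exists i v w, [/\ (code B).2 i = Some v, (code C).2 i = Some w & v <> w].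
  move=> EB EC BC; apply: contrapT => compat; apply: BC; apply: disjE => //.
  (* The union of both codes, completed by the value 0. *)
  pose t : T := fun i => d i (odflt (odflt 0%N ((code C).2 i)) ((code B).2 i)).
  exists t; split.
    by apply: (codeE B EB).2 => i n E1; rewrite /t E1.
  apply: (codeE C EC).2 => i n E2; rewrite /t E2.
  case E1: ((code B).2 i) => [v|//] /=; congr (d i _).
  by apply: contrapT => vn; apply: compat; exists i, v, n.
have codeI : {in E &, injective (snd \o code)}.
  move=> B C /set_mem EB /set_mem EC BC; apply: contrapT => neqBC.
  have [i [v [w [Bv Cw vw]]]] := compat _ _ EB EC neqBC; apply: vw.
  by move: Cw; rewrite -[(code C).2]BC /= Bv => -[].
rewrite -(eq_countable (inj_card_eq codeI)).
rewrite (_ : _ @` _ = \bigcup_n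
    ((snd \o code) @` [set B | E B /\ size (code B).1 <= n]%N)).
  apply: bigcup_countable => // n _; apply: (@countable_incompatible _ n).
    by move=> _ [B [EB sB] <-]; exists (code B).1 => //; exact: (codeE B EB).1.
  move=> _ _ [B [EB _] <-] [C [EC _] <-] BC; apply: compat => // E1.
  by apply: BC; rewrite E1.
apply/seteqP; split=> [_ [B EB <-]|_ [n _ [B [EB _] <-]]]; last by exists B.
by exists (size (code B).1) => //; exists B.
Qed.

(** Take a maximal disjoint family of nonempty finitely determined open sets
    satisfying [Q]. It is countable by the chain condition, and its union is dense
    by maximality. The empty set serves to turn the family into a sequence. *)
Lemma dense_determined_cover (Q : set (set T)) :
  Q set0 -> (forall V W, W `<=` V -> Q V -> Q W) ->
  (forall V, open V -> V !=set0 ->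
     exists W, [/\ W `<=` V, open W, W !=set0 & Q W]) ->
  exists (B : nat -> set T) (l : nat -> seq I),
    (forall n, [/\ open (B n), determined_by (l n) (B n) & Q (B n)]) /\
    dense (\bigcup_n B n).
Proof.
move=> Q0 Qsub Qdense.
pose D : set (set T) :=
  [set B | [/\ open B, exists l, determined_by l B, Q B & B !=set0]].
have [E [ED disjE maxE]] := ex_maximal_disjoint_subcollection id D.
have /countable_injP[g gI] : countable E.
  by apply: disjoint_open_countable => // B /ED[].
pose B n := xget set0 [set B | E B /\ g B = n].
have BE n : E (B n) \/ B n = set0.
  by rewrite /B; case: xgetP => [A _ [EA _]|_]; [left|right].
have Bg C : E C -> B (g C) = C.
  move=> EC; rewrite /B; case: xgetP => [A _ [EA gA]|/(_ C)[]//].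
  by apply: gI => //; exact: mem_set.
have BP n : exists l, [/\ open (B n), determined_by l (B n) & Q (B n)].
  have [/ED[oB [l lB] QB _]|->] := BE n; first by exists l.
  by exists [::]; split=> //; exact: open0.
have /choice[l lP] := BP; exists B, l; split=> // V V0 oV.
apply: contrapT => VB.
have [W [WV oW [t Wt] QW]] := Qdense V oV V0.
have /nbhs_box[l' [U [oU Ut UW]]] : nbhs t W by exact: open_nbhs_nbhs.
have nU C : E C -> C `&` box l' U = set0.
  move=> EC; apply/seteqP; split=> // u [Cu Uu]; apply: VB; exists u; split.
    exact/WV/UW.
  by exists (g C); rewrite ?Bg.
have DU : D (box l' U).
  split; [exact: open_box|by exists l'; exact: box_determined|exact: Qsub UW QW|by exists t].
apply: (maxE (box l' U |` E)).
- split; first by move=> C EC; right.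
  move=> /(_ (box l' U) (or_introl erefl)) /nU; rewrite setIid => U0.
  by have : set0 t by rewrite -U0.
- by move=> C [->//|/ED].
- move=> C C' [->|EC] [->|EC'] //=; last exact: disjE.
    by rewrite setIC nU// => -[].
  by rewrite nU// => -[].
Qed.

(** Closing off a countable set of points under all the one-coordinate
    modifications allowed by [l] gives a countable set whose elements take all
    combinations of values of the dense sequences on any finite set of coordinates
    occurring in [l], and may equal [a] elsewhere. So the point that
    coincides with [t] on these coordinates and with [a] off them is in its
    closure. Finite trees, evaluated by [skolem_term], enumerate the closed-off
    set. *)
Lemma countable_reflecting_set (a : T) (l : seq T -> nat -> seq I) :
  exists (C : countType) (e : C -> T), forall t, exists2 t',
    closure (range e) t' & forall s n i, i \in l (map e s) n -> t i = t' i.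
Proof.
(* The number [m] codes which coordinate of [l s n] of [t] is to be modified, and
   by which term of the corresponding dense sequence. *)
pose Phi (s : seq T) (m : nat) : T :=
  if s is t :: s' then
    let: (n, (j, k)) := odflt (0, (0, 0))%N (unpickle m) in
    if onth (l s' n) j is Some i then dfwith t i (d i k) else t
  else a.
pose e := skolem_term Phi.
have e_with c s n i k : i \in l (map e s) n ->
    exists c', e c' = dfwith (e c) i (d i k).
  move=> il; pose m := pickle (n, (index i (l (map e s) n), k)).
  exists (GenTree.Node m (c :: s)).
  rewrite [LHS](_ : _ = Phi (e c :: map e s) m)// /Phi pickleK /=.
  by rewrite (_ : onth _ _ = Some i)// onthE (nth_map i) ?index_mem// nth_index.
exists (GenTree.tree nat), e => t.
pose J i := exists s n, i \in l (map e s) n.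
pose t' : T := fun i => if pselect (J i) then t i else a i.
exists t'; last first.
  by move=> s n i il; rewrite /t'; case: pselect => // -[]; exists s, n.
move=> N /nbhs_box[L [U [oU Ut UN]]].
(* The coordinates in [L] that [l] never mentions are left equal to [a]. *)
suff [c [cU _]] : exists c, box L U (e c) /\ forall i, ~ J i -> e c i = a i.
  by exists (e c); split; [exists c|exact: UN].
elim: L Ut {UN} => [|i L IHL] Ut; first by exists (GenTree.Leaf 0).
have [|c [cU ca]] := IHL; first by move=> j jL; apply: Ut; rewrite inE jL orbT.
have [Ji|nJi] := pselect (J i); last first.
  exists c; split=> // j; rewrite inE => /predU1P[->|]; last exact: cU.
  by rewrite ca//; have := Ut i (mem_head _ _); rewrite /t'; case: pselect.
have [k Uk] := dense_coordinate (oU i) (Ut i (mem_head _ _)).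
have [s [n il]] := Ji; have [c' c'E] := e_with c s n i k il.
exists c'; rewrite c'E; split=> j.
  rewrite inE; have [->|ji] := eqVneq j i; first by rewrite dfwithin.
  by move=> /= jL; rewrite dfwithout 1?eq_sym//; exact: cU.
by move=> nJj; rewrite dfwithout ?ca//; apply/eqP => ij; apply: nJj; rewrite -ij.
Qed.

End product_of_separable_spaces.

(** * Separately continuous functions of small oscillation *)

Section oscillation.
Local Open Scope ring_scope.
Variables (R : realType) (T : topologicalType) (X : choiceType) (F : T -> X -> R).
Hypothesis F01 : forall t x, 0 <= F t x <= 1.
Hypothesis F_continuousl : forall x, continuous (F^~ x).

(** Cut the cube of functions from [s] to [0, 1] into cells of side [delta], and
    take the cell of [(F t x)_(t in s)]. *)
Lemma finite_cells (s : seq T) (delta : R) : 0 < delta ->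
  exists (K : finType) (c : X -> K), forall x y, c x = c y ->
    forall t, t \in s -> `|F t x - F t y| <= delta.
Proof.
move=> delta0; pose N := Num.truncn delta^-1.
exists {ffun seq_sub s -> 'I_N.+1}.
exists (fun x => [ffun t => inord (Num.truncn (F (val t) x / delta))]).
move=> x y cxy t ts; have /ffunP/(_ (SeqSub ts)) := cxy; rewrite !ffunE /=.
have FN z : (Num.truncn (F t z / delta) < N.+1)%N.
  rewrite ltnS; apply: le_truncn; rewrite ler_piMl ?invr_ge0 ?(ltW delta0)//.
  by have /andP[] := F01 t z.
move=> /(congr1 val); rewrite /= !inordK// => Exy.
have Fd z : 0 <= F t z / delta by rewrite divr_ge0 ?(ltW delta0)//; have /andP[] := F01 t z.
have /andP[] := truncn_itv (Fd x); have /andP[] := truncn_itv (Fd y).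
rewrite Exy ler_pdivlMr// ltr_pdivrMr// ler_pdivlMr// ltr_pdivrMr//.
rewrite -natr1 mulrDl mul1r => ? ? ? ?; rewrite ler_norml; apply/andP; split; lra.
Qed.

(** Choose a representative in each cell. Some neighbourhood of a point of [V] has
    small oscillation at each of these finitely many representatives, but large
    oscillation at some [x], so the representative of the cell of [x] must be
    separated from [x] somewhere on this neighbourhood. *)
Lemma exists_close_pair (eps delta : R) (s : seq T) (V : set T) :
  0 < eps -> 0 < delta ->
  (forall W, open W -> W !=set0 ->
     exists t u x, [/\ W t, W u & eps < `|F t x - F u x|]) ->
  open V -> V !=set0 ->
  exists t x y, [/\ V t, eps / 4 < `|F t x - F t y|
    & forall u, u \in s -> `|F u x - F u y| <= delta].
Proof.
move=> eps0 delta0 oscF oV V0; have [t0 Vt0] := V0.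
have [_ [_ [x0 _]]] := oscF _ oV V0.
have [K [c cP]] := finite_cells s delta0.
pose z k := xget x0 [set x | c x = k].
have zP x : c (z (c x)) = c x.
  by rewrite /z; case: xgetP => [y _ //|/(_ x)[]].
have : nbhs t0 (V `&` [set t | forall k, `|F t0 (z k) - F t (z k)| < eps / 4]).
  apply: filterI; first exact: open_nbhs_nbhs.
  apply: filter_forall => k.
  by have /cvgrPdist_lt := @F_continuousl (z k) t0; apply; rewrite divr_gt0.
rewrite nbhsE => -[W [oW Wt0] WP].
have [||t [u [x [Wt Wu tux]]]] := oscF W; [exact: oW|by exists t0|].
have [Vt /(_ (c x)) tz] := WP _ Wt; have [Vu /(_ (c x)) uz] := WP _ Wu.
have close v : v \in s -> `|F v x - F v (z (c x))| <= delta by apply: cP; rewrite zP.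
have [tx|tx] := ltP (eps / 4) `|F t x - F t (z (c x))|.
  by exists t, x, (z (c x)).
exists u, x, (z (c x)); split=> //; rewrite ltNge; apply/negP => ux.
move: tux tz uz tx ux; set a := F t x; set b := F u x; set p := F t _; set q := F u _; set r := F t0 _.
rewrite !ltr_norml !ler_norml ltNge ler_norml => /negP + /andP[? ?] /andP[? ?] /andP[? ?] /andP[? ?].
by apply; apply/andP; split; lra.
Qed.

End oscillation.

Section small_oscillation.
Local Open Scope ring_scope.
Variables (R : realType) (I : choiceType) (S : I -> topologicalType).
Local Notation T := (prod_topology S).
Variables (X : topologicalType) (F : T -> X -> R) (eps : R).
Hypothesis sepS : forall i, separable (S i).
Hypothesis nmT : non_meager T.
Hypothesis ccX : countably_compact (X * X)%type.
Hypothesis F01 : forall t x, 0 <= F t x <= 1.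
Hypothesis F_continuousl : forall x, continuous (F^~ x).
Hypothesis F_continuousr : forall t, continuous (F t).
Hypothesis eps0 : 0 < eps.

(** The pairs [(x, y)] with [F t' x] and [F t' y] at distance at least [eps / 4],
    but [F (e c) x] and [F (e c) y] at distance at most [1 / (size s + 1)] for all
    [c] in [s], form closed sets [K s] directed by concatenation of [s]. A common
    point of all of them is a pair not separated by [F u] for [u] in the range
    of [e], although it is separated by [F t'], where [t'] is in the closure
    of this range. *)
Lemma small_oscillation :
  exists W : set T, [/\ open W, W !=set0 &
    forall t u x, W t -> W u -> `|F t x - F u x| <= eps].
Proof.
apply: contrapT => noW.
have oscF (W : set T) : open W -> W !=set0 ->
    exists t u x, [/\ W t, W u & eps < `|F t x - F u x|].
  move=> oW W0; apply: contrapT => noosc; apply: noW; exists W; split=> // t u x Wt Wu.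
  by rewrite leNgt; apply/negP => tux; apply: noosc; exists t, u, x.
have [a _] : exists a : T, True.
  by have [] := @non_meager_bigcap_dense _ unit (fun=> setT) nmT;
    [move=> _; exact: openT|move=> _ V [t Vt] _; exists t|move=> a; exists a].
have sep_seq i : {d : nat -> S i | dense (range d)}.
  exact: cid (separable_dense_range (a i) (sepS i)).
pose d i := sval (sep_seq i).
have dense_d i : dense (range (d i)) := svalP (sep_seq i).
have [_ [_ [x0 _]]] := oscF _ openT (ex_intro _ a Logic.I).
pose close (s : seq T) x y :=
  forall t, t \in s -> `|F t x - F t y| <= (size s).+1%:R^-1.
pose Q (s : seq T) (V : set T) := exists x y,
  close s x y /\ forall t, V t -> eps / 4 < `|F t x - F t y|.
have /choice[B /choice[l BP]] : forall s : seq T,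
    exists (B : nat -> set T) (l : nat -> seq I),
    (forall n, [/\ open (B n), determined_by (l n) (B n) & Q s (B n)]) /\
    dense (\bigcup_n B n).
  move=> s; apply: (dense_determined_cover dense_d).
  - by exists x0, x0; split=> // t _; rewrite subrr normr0 invr_ge0.
  - by move=> V W WV [x [y [cxy Vxy]]]; exists x, y; split=> // t /WV; exact: Vxy.
  - move=> V oV V0; have e0 : 0 < (size s).+1%:R^-1 :> R by rewrite invr_gt0.
    have [t [x [y [Vt txy cxy]]]] := exists_close_pair F01 F_continuousl s eps0 e0 oscF oV V0.
    exists (V `&` [set t | eps / 4 < `|F t x - F t y|]); split.
    + by move=> ? [].
    + apply: openI => //; apply: (@open_comp _ _ (fun t => `|F t x - F t y|) [set r | eps / 4 < r]).
        by move=> u _; exact: (cvg_norm (cvgB (@F_continuousl x u) (@F_continuousl y u))).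
      exact: open_gt.
    + by exists t.
    + by exists x, y; split=> // ? [].
have [C [e reflect_e]] := countable_reflecting_set dense_d a l.
have [t tB] : exists t, forall s : seq C, (\bigcup_n B (map e s) n) t.
  apply: non_meager_bigcap_dense => // s; last exact: (BP _).2.
  by apply: bigcup_open => n _; have [] := (BP (map e s)).1 n.
have [t' t'cl tt'] := reflect_e t.
have t'B s n : B (map e s) n t -> B (map e s) n t'.
  by have [_ + _] := (BP (map e s)).1 n; apply=> i; exact: tt'.
pose K (s : seq C) : set (X * X) :=
  [set p | eps / 4 <= `|F t' p.1 - F t' p.2|] `&`
  [set p | forall c, c \in s -> `|F (e c) p.1 - F (e c) p.2| <= (size s).+1%:R^-1].
have cF u : continuous (fun p : X * X => `|F u p.1 - F u p.2|).
  move=> p; apply: cvg_norm; apply: cvgB.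
    apply: (@cvg_comp _ _ _ fst (F u) _ (nbhs p.1)); first exact: cvg_fst.
    exact: F_continuousr.
  apply: (@cvg_comp _ _ _ snd (F u) _ (nbhs p.2)); first exact: cvg_snd.
  exact: F_continuousr.
have [||[x y] Kxy] := countably_compact_bigcap (K := K) ccX.
- move=> s; apply: closedI.
    apply: (@closed_comp _ _ _ [set r | eps / 4 <= r] _ (@closed_ge _ _)).
    by move=> p _; exact: cF.
  rewrite (_ : [set p | _] = \bigcap_(c in [set` s])
    [set p | `|F (e c) p.1 - F (e c) p.2| <= (size s).+1%:R^-1]).
    apply: closed_bigI => c _.
    apply: (@closed_comp _ _ _ [set r | r <= _] _ (@closed_le _ _)).
    by move=> p _; exact: cF.
  by apply/seteqP; split.
- move=> ss; pose s := flatten ss.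
  have [n _ Bt] := tB s; have [_ _ [x [y [cxy Bxy]]]] := (BP (map e s)).1 n.
  exists (x, y) => s' s'ss; split=> /=; first exact/ltW/Bxy/t'B.
  move=> c cs'; apply: le_trans (cxy (e c) _) _.
    by apply: map_f; apply/flattenP; exists s'.
  rewrite lef_pV2 ?posrE// ler_nat ltnS size_map /s size_flatten sumnE.
  by rewrite big_map (big_rem s')//= leq_addr.
- have Fxy c : F (e c) x = F (e c) y.
    apply/eqP; rewrite -subr_eq0 -normr_le0; apply/ler_addgt0Pl => r r0.
    (* Repeating [c] makes the bound [1 / (size s + 1)] smaller than [r]. *)
    rewrite addr0; pose n := Num.truncn r^-1.
    have [_ /(_ c)] := Kxy (nseq n.+1 c); rewrite mem_nseq eqxx size_nseq => /(_ isT).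
    move/le_trans; apply; rewrite -[leRHS]invrK lef_pV2 ?posrE ?invr_gt0//.
    by apply/ltW/(lt_le_trans (truncnS_gt _)); rewrite ler_nat.
  suff Ft' : F t' x = F t' y.
    by have [/= + _] := Kxy [::]; rewrite Ft' subrr normr0 leNgt divr_gt0.
  apply/eqP; rewrite -subr_eq0; apply/eqP.
  have : closed [set u | F u x - F u y = 0].
    apply: (@closed_comp _ _ (fun u => F u x - F u y) [set 0]) => [u _|]; last exact: closed_eq.
    exact: (cvgB (@F_continuousl x u) (@F_continuousl y u)).
  move/closure_id => cl0; suff : [set u | F u x - F u y = 0] t' by [].
  rewrite cl0; apply: closure_subset t'cl => _ [c _ <-] /=.
  by rewrite Fxy subrr.
Qed.

End small_oscillation.

(** * From an open subgroup to the action *)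

Section open_subgroup.
Variables (H : rightTopologicalGroupType) (G : openSubgroup H).
Local Open Scope group_scope.

Lemma mulg_right_continuous_sub (s : G) : continuous (fun x : G => x * s).
Proof.
move=> x N [_ [[A oA <-] Ax AN]]; rewrite /= in Ax AN.
exists ((fun y : G => val y * val s) @^-1` A); split=> //; last first.
  by move=> y Ay; apply: AN; rewrite /= set_valE.
exists ((fun h : H => h * val s) @^-1` A) => //.
by apply: open_comp => // h _; exact: mulg_right_continuous.
Qed.

(** The cosets [G h] are open. Choose a representative [r h] of each, and map [h]
    to [h * (r h)^-1]: locally this is a right translation, and left multiplication
    by an element of [G] does not change the coset. *)
Lemma open_subgroup_retract : exists rho : H -> G,
  continuous rho /\ forall (g : G) h, rho (val g * h) = g * rho h.
Proof.
have [G1 _] := openSubgroup_group_closed G.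
have GV := group_closedV (openSubgroup_group_closed G).
have GM := group_closedM (openSubgroup_group_closed G).
pose coset h := [set k : H | h * k^-1 \in (G : set H)].
have coset_eq h h' : h * h'^-1 \in (G : set H) -> coset h = coset h'.
  move=> hh'; apply/seteqP; split=> k /=; rewrite /coset /= => kG.
    rewrite (_ : h' * k^-1 = (h * h'^-1)^-1 * (h * k^-1)); first exact: GM (GV _ hh') kG.
    by rewrite invgM invgK -mulgA mulKg.
  rewrite (_ : h * k^-1 = (h * h'^-1) * (h' * k^-1)); first exact: GM hh' kG.
  by rewrite -mulgA mulKg.
pose r h := xget 1 (coset h).
have rG h : h * (r h)^-1 \in (G : set H).
  by rewrite /r; case: xgetP => [//|/(_ h)[]]; rewrite /coset /= mulgV.
pose rho h : G := exist _ (h * (r h)^-1) (rG h).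
exists rho; split=> [h N [_ [[A oA <-] Ah AN]]|g h]; last first.
  apply: val_inj; rewrite /= /r (coset_eq _ h) ?mulgA//.
  by rewrite mulgK; exact: valP.
have : nbhs h ([set k | (G : set H) (k * h^-1)] `&` [set k | A (k * (r h)^-1)]).
  apply: filterI.
    apply: (mulg_right_continuous h^-1 h); rewrite mulgV.
    by apply: open_nbhs_nbhs; split; [exact: openSubgroup_open|exact: set_mem].
  by apply: (mulg_right_continuous (r h)^-1 h); exact: open_nbhs_nbhs.
apply: filterS => k [kG Ak]; apply: AN => /=.
by rewrite set_valE /= /r (coset_eq _ h)//; exact: mem_set.
Qed.

End open_subgroup.

Section equicontinuity.
Local Open Scope ring_scope.
Variables (R : realType) (H : rightTopologicalGroupType) (G : openSubgroup H).
Variables (X : topologicalType) (pi : G * X -> X) (f : X -> R).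
Hypothesis hHsep : Pi_separable H.
Hypothesis hHnm : non_meager H.
Hypothesis hXcc : countably_compact (X * X)%type.
Hypothesis hact : left_action pi.
Hypothesis hsep : separately_continuous pi.
Hypothesis f_continuous : continuous f.
Hypothesis f01 : forall y, 0 <= f y <= 1.

(** Transport [(h, x) |-> f (rho h x)] to the product space, where [rho] retracts
    [H] onto [G], and find a nonempty open set of small oscillation there. For a point
    [h] of the corresponding open set of [H] and [g] near [1], the points [g h] and [h]
    are both in it, and [rho (g h) = g (rho h)]; then replace [y] by
    [(rho h)^-1 y]. *)
Lemma action_equicontinuous (eps : R) : 0 < eps ->
  \forall g \near (1%g : G), forall y, `|f (pi (g, y)) - f y| <= eps.
Proof.
move=> eps0; have [I [S [sepS [p [q [pK qK cp cq]]]]]] := hHsep.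
have [rho [crho rhoM]] := open_subgroup_retract G.
pose F (t : prod_topology (S : {classic I} -> _)) x := f (pi (rho (q t), x)).
have [||||W [oW [t Wt] oscW]] := @small_oscillation R {classic I} S X F eps sepS _ hXcc _ _ _ eps0.
- exact: homeomorphic_non_meager pK qK cp cq hHnm.
- by move=> t x; exact: f01.
- move=> x t.
  apply: (@continuous_comp _ _ _ (fun u : prod_topology S => pi (rho (q u), x)) f); last exact: f_continuous.
  apply: (@continuous_comp _ _ _ (fun u : prod_topology S => rho (q u)) (fun g => pi (g, x))); last exact: hsep.2.
  apply: (@continuous_comp _ _ _ q rho); [exact: cq|exact: crho].
- move=> t x; apply: (@continuous_comp _ _ _ (fun x => pi (rho (q t), x)) f); last exact: f_continuous.
  exact: hsep.1.
have : nbhs (1%g : G) [set g : G | W (p (val g * q t)%g)].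
  exists [set g : G | W (p (val g * q t)%g)]; split=> //; last by rewrite /= mul1g qK.
  exists [set h | W (p (h * q t)%g)] => //.
  apply: (@open_comp _ _ (fun h => p (h * q t)%g)) => // h _.
  apply: (@continuous_comp _ _ _ (fun h => h * q t)%g p); [exact: mulg_right_continuous|exact: cp].
apply: filterS => g Wg y.
have := oscW _ _ (pi ((rho (q t))^-1%g, y)) Wg Wt.
by rewrite /F pK rhoM -!hact.2 -mulgA mulgV mulg1 hact.1.
Qed.

End equicontinuity.

Theorem corollary2p6 (R : realType) (H : rightTopologicalGroupType)
    (hHsep : Pi_separable H) (hHnm : non_meager H) (G : openSubgroup H)
    (X : topologicalType) (hXcr : completely_regular R X)
    (hXcc : countably_compact (X * X)%type)
    (pi : G * X -> X) (hact : left_action pi)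
    (hsep : separately_continuous pi) :
  continuous pi.
Proof.
move=> [t x] U /hXcr[f [cf f01 fx f1]].
have e0 : (0 < 2^-1 :> R)%R by [].
have near1 := action_equicontinuous hHsep hHnm hXcc hact hsep cf f01 e0.
pose A : set G := [set g | forall y, `|f (pi (g, y)) - f y| <= 2^-1]%R.
have near_t : nbhs t [set s : G | A (s * t^-1)%g].
  have A1 : nbhs (t * t^-1 : G)%g A by rewrite (@mulgV G).
  exact: (mulg_right_continuous_sub A1).
have near_x : nbhs x [set y | `|f (pi (t, y))| < 2^-1]%R.
  have cfx : f (pi (t, y)) @[y --> x] --> f (pi (t, x)).
    apply: (@continuous_comp _ _ _ (fun y => pi (t, y)) f); last exact: cf.
    exact: hsep.1.
  apply: filterS (cvgr_dist_lt _ _ cfx _ e0) => y /=.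
  by rewrite fx sub0r normrN.
exists ([set s : G | A (s * t^-1)%g],
        [set y | `|f (pi (t, y))| < 2^-1]%R) => // -[s y] /= [/(_ (pi (t, y))) + ty].
rewrite -hact.2 mulgVK => sy; apply: contrapT => /f1 fsy; move: sy ty.
rewrite fsy ltr_norml ler_norml => /andP[? ?] /andP[? ?]; lra.
Qed.
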